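(* Let $K$ be a zero-dimensional compact Hausdorff space whose set of isolated points is dense in $K$. Then every non-expansive homeomorphism $F:B_{C(K)}\to B_{C(K)}$ is an isometry.
   Context: $C(K)$ denotes the Banach space of real-valued continuous functions on $K$ with the supremum norm, and $B_{C(K)}$ its closed unit ball. A topological space is zero-dimensional if it has a basis consisting of clopen sets. A map is non-expansive if it is $1$-Lipschitz. *)

(* Defs.v *)
From HB Require Import structures.
From mathcomp Require Import all_boot all_order all_algebra.
From mathcomp Require Import all_classical all_reals all_analysis.
Set Implicit Arguments. Unset Strict Implicit. Unset Printing Implicit Defensive.
Import Order.TTheory GRing.Theory Num.Theory.
Import numFieldNormedType.Exports.
Local Open Scope classical_set_scope.
Local Open Scope ring_scope.

(* Zero-dimensional in the sense of the paper: the clopen sets form a basis. *)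
Definition clopen_basis (T : topologicalType) : Prop :=
  forall (x : T) (U : set T), nbhs x U ->
    exists V : set T, [/\ clopen V, V x & V `<=` U].

Definition CK (K : topologicalType) (R : realType) : set (K -> R) :=
  [set f | continuous f].

Definition supdist (K : topologicalType) (R : realType) (f g : K -> R) : R :=
  sup (range (fun x => `|f x - g x|)).

Definition supnorm (K : topologicalType) (R : realType) (f : K -> R) : R :=
  sup (range (fun x => `|f x|)).

Definition BCK (K : topologicalType) (R : realType) : set (K -> R) :=
  [set f | CK f /\ supnorm f <= 1].

Definition ball_continuous (K : topologicalType) (R : realType)
    (F : (K -> R) -> (K -> R)) : Prop :=
  forall f, BCK f -> forall e : R, 0 < e -> exists2 d : R, 0 < d &
    forall g, BCK g -> supdist f g < d -> supdist (F f) (F g) < e.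

Definition ball_homeomorphism (K : topologicalType) (R : realType)
    (F : (K -> R) -> (K -> R)) : Prop :=
  [/\ (forall f, BCK f -> BCK (F f)),
      ball_continuous F &
      exists G : (K -> R) -> (K -> R),
        [/\ (forall f, BCK f -> BCK (G f)),
            (forall f, BCK f -> G (F f) = f),
            (forall f, BCK f -> F (G f) = f) &
            ball_continuous G]].

Definition ball_nonexpansive (K : topologicalType) (R : realType)
    (F : (K -> R) -> (K -> R)) : Prop :=
  forall f g, BCK f -> BCK g -> supdist (F f) (F g) <= supdist f g.

Definition ball_isometry (K : topologicalType) (R : realType)
    (F : (K -> R) -> (K -> R)) : Prop :=
  forall f g, BCK f -> BCK g -> supdist (F f) (F g) = supdist f g.

(* Main.v *)
Require Import Defs.
From HB Require Import structures.
From mathcomp Require Import all_boot all_order all_algebra.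
From mathcomp Require Import all_classical all_reals all_analysis.
From mathcomp Require Import lra.
Import Order.TTheory GRing.Theory Num.Theory.
Import numFieldNormedType.Exports.
Local Open Scope classical_set_scope.
Local Open Scope ring_scope.

(** Let G be the inverse of F. Looking at the images under F of the functions
    supported by one isolated point t, nonexpansiveness and injectivity force
    F (a 1_t) to be supported by one isolated point k = sg t, and then
    G u t = th t * u k for every u in the ball with |u k| = 1, where th t = 1
    or -1. Given a continuous e with |e| = 1, the map F carries the orthant
    {z | z * G e >= 0} onto {u | u * e >= 0}: continuity of G is needed here,
    to follow G along the segment from e to u. Both orthants (intersected with
    the ball) are balls of radius 1/2, so after rescaling F restricts to a map
    of the same kind, with the same sg and th. Iterating n times gives
    |G u t - th t * u (sg t)| <= 2 / 2 ^ n for all u, so G is a weighted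
    composition operator, hence an isometry. *)

(** * Unit ball, sign functions and inverse pairs *)

Section UnitBall.
Variables (R : realType) (K : topologicalType).
Implicit Types (f g u v x y z e : K -> R) (k t p : K) (F G : (K -> R) -> (K -> R)).

Definition ball1 f := continuous f /\ forall p, `|f p| <= 1.

Definition sign_function e := continuous e /\ forall p, `|e p| = 1.

Definition upd f k (a : R) : K -> R := fun p => if p == k then a else f p.

(** Distances are pointwise bounds rather than suprema, so that the rescaled maps can be shown to
    form such a pair by linear arithmetic at each point. *)
Record contraction_pair F G : Prop := {
  contraction_ball : forall f, ball1 f -> ball1 (F f);
  inverse_ball : forall f, ball1 f -> ball1 (G f);
  contractionK : forall f, ball1 f -> G (F f) = f;
  inverseK : forall f, ball1 f -> F (G f) = f;
  contractionP : forall f g, ball1 f -> ball1 g -> forall r,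
    (forall p, `|f p - g p| <= r) -> forall p, `|F f p - F g p| <= r;
  inverse_continuous : forall f, ball1 f -> forall eps, 0 < eps ->
    exists2 d, 0 < d & forall g, ball1 g ->
      (forall p, `|f p - g p| <= d) -> forall p, `|G f p - G g p| <= eps }.

Lemma norm1P (a : R) : `|a| = 1 <-> a = 1 \/ a = -1.
Proof.
split=> [|[->|->]]; rewrite ?normrN ?normr1//.
by case: (ger0P a) => _ h; [left|right; rewrite -h opprK].
Qed.

Lemma updE f k a : upd f k a k = a.
Proof. by rewrite /upd eqxx. Qed.

Lemma updN f k a p : p <> k -> upd f k a p = f p.
Proof. by rewrite /upd => /eqP/negbTE ->. Qed.

Lemma ball1_sign e : sign_function e -> ball1 e.
Proof. by case=> ce e1; split=> // p; rewrite e1. Qed.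

Lemma ball1_cst (a : R) : `|a| <= 1 -> ball1 (fun=> a).
Proof. by move=> a1; split=> //; exact: cst_continuous. Qed.

Lemma sign_function_cst (a : R) : `|a| = 1 -> sign_function (fun=> a).
Proof. by move=> a1; split=> //; exact: cst_continuous. Qed.

Lemma continuous_lincomb f g (a b : R) : continuous f -> continuous g ->
  continuous (fun p => a * f p + b * g p).
Proof.
move=> cf cg p; apply: cvgD; apply: cvgM;
  by [exact: cvg_cst|exact: cf|exact: cg].
Qed.

Lemma continuous_opp f : continuous f -> continuous (fun p => - f p).
Proof. by move=> cf p; apply: cvgN; exact: cf. Qed.

Lemma sign_functionN e : sign_function e -> sign_function (fun p => - e p).
Proof. by case=> ce e1; split=> [|p]; [exact: continuous_opp|rewrite normrN]. Qed.

(** Extends paths parametrised by [[0, 1]] to the whole line without leaving the ball. *)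
Definition clamp (s : R) : R := Num.max 0 (Num.min 1 s).

Lemma clampP s : 0 <= clamp s <= 1.
Proof. by rewrite /clamp /Num.max /Num.min; do 2 case: ifP; lra. Qed.

Lemma clamp_id s : 0 <= s -> s <= 1 -> clamp s = s.
Proof. by rewrite /clamp /Num.max /Num.min; do 2 case: ifP; lra. Qed.

Lemma clamp_dist s s' : `|clamp s - clamp s'| <= `|s - s'|.
Proof.
have h : s - s' <= `|s - s'| := ler_norm _.
have h' : s' - s <= `|s - s'| by rewrite distrC ler_norm.
rewrite ler_norml; move: h h'.
rewrite /clamp /Num.max /Num.min.
by case: (ltP 1 s); case: (ltP 1 s'); rewrite ?ltr01; case: (ltP 0 s); case: (ltP 0 s'); lra.
Qed.

Hypothesis hT2 : hausdorff_space K.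

Lemma continuous_upd f k a : open [set k] -> continuous f -> continuous (upd f k a).
Proof.
move=> ok cf p; have [->|/eqP pk] := eqVneq p k.
  have nk : nbhs k [set k] by exact: open_nbhs_nbhs.
  by apply: (near_cst_continuous a); apply: filterS nk => q ->; rewrite updE.
have : nbhs p (~` [set k]).
  apply: open_nbhs_nbhs; split; last by move=> /= /pk.
  by rewrite openC; exact: accessible_closed_set1 (hausdorff_accessible hT2) _.
move=> npk; rewrite /continuous_at /prop_for updN//.
apply: cvg_trans (cf p); apply: near_eq_cvg.
by apply: filterS npk => q /= qk; rewrite updN.
Qed.

Lemma ball1_upd f k a : open [set k] -> ball1 f -> `|a| <= 1 -> ball1 (upd f k a).
Proof.
by move=> ok [cf f1] a1; split=> [|p]; [exact: continuous_upd|rewrite /upd; case: ifP].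
Qed.

Lemma sign_function_upd e k a : open [set k] -> sign_function e -> `|a| = 1 ->
  sign_function (upd e k a).
Proof.
by move=> ok [cf f1] a1; split=> [|p]; [exact: continuous_upd|rewrite /upd; case: ifP].
Qed.

(** * Reduction to isolated points *)

Hypothesis hiso : dense (isolated [set: K]).

(** The set where [f > g] is open; if nonempty, it contains an isolated point. *)
Lemma isolated_dense_le f g : continuous f -> continuous g ->
  (forall k, open [set k] -> f k <= g k) -> forall p, f p <= g p.
Proof.
move=> cf cg fg p; rewrite leNgt; apply/negP => gfp.
pose h := fun q => 1 * f q + (-1) * g q.
have ch : continuous h by exact: continuous_lincomb.
have oh : open (h @^-1` [set r | 0 < r]).
  by apply: open_comp; [move=> q _; exact: ch|exact: open_gt].
have hp : h @^-1` [set r | 0 < r] !=set0 by exists p; rewrite /= /h; lra.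
have [k [/= hk [_ [V nV]]]] := hiso _ hp oh.
rewrite setIT => Vk; rewrite {}Vk in nV.
have ok : open [set k] by rewrite openE => q ->.
by move: (fg k ok) hk; rewrite /h; lra.
Qed.

Lemma isolated_dense_dist f g (r : R) : continuous f -> continuous g ->
  (forall k, open [set k] -> `|f k - g k| <= r) -> forall p, `|f p - g p| <= r.
Proof.
move=> cf cg fg p; rewrite ler_norml; apply/andP; split.
  have := @isolated_dense_le (fun=> - r) (fun p => 1 * f p + (-1) * g p).
  move=> /(_ (@cst_continuous _ _ _) (continuous_lincomb _ _ _ _ cf cg)) h.
  have h1 k : open [set k] -> - r <= 1 * f k + (-1) * g k.
    by move=> /fg; rewrite ler_norml; lra.
  by have := h h1 p; lra.
have := @isolated_dense_le (fun p => 1 * f p + (-1) * g p) (fun=> r).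
move=> /(_ (continuous_lincomb _ _ _ _ cf cg) (@cst_continuous _ _ _)) h.
have h1 k : open [set k] -> 1 * f k + (-1) * g k <= r.
  by move=> /fg; rewrite ler_norml; lra.
by have := h h1 p; lra.
Qed.

Lemma isolated_dense_eq f g : continuous f -> continuous g ->
  (forall k, open [set k] -> f k = g k) -> f = g.
Proof.
move=> cf cg fg; apply/funext => p; apply/eqP; rewrite -subr_eq0 -normr_le0.
by apply: isolated_dense_dist => // k /fg ->; rewrite subrr normr0.
Qed.

(** * Images of sign functions and of spikes *)

Section Pair.
Variables (F G : (K -> R) -> (K -> R)).
Hypothesis FG : contraction_pair F G.

Lemma contraction_inj f g : ball1 f -> ball1 g -> F f = F g -> f = g.
Proof. by move=> bf bg /(congr1 G); rewrite !(contractionK _ _ FG). Qed.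

(** As [u = F (G u)], this is nonexpansiveness at [G u] and [z]. It is the main tool: a test
    function [z] close to [G u] yields information on [F z]. *)
Lemma dist_inverse u z (r : R) : ball1 u -> ball1 z ->
  (forall p, `|G u p - z p| <= r) -> forall p, `|u p - F z p| <= r.
Proof.
move=> bu bz h; move=> p; rewrite -{1}(inverseK _ _ FG u bu); move: p.
exact: (contractionP _ _ FG) (inverse_ball _ _ FG _ bu) _ _ _.
Qed.

(** Every [G u] lies within 1 of 0, so [F 0] lies within 1 of both constants 1 and -1. *)
Lemma contraction0 : F (fun=> 0) = fun=> 0.
Proof.
apply/funext => p.
have b0 : ball1 (fun=> 0) by apply: ball1_cst; rewrite normr0.
have h a : `|a| = 1 -> `|a - F (fun=> 0) p| <= 1.
  move=> a1; apply: (dist_inverse (fun=> a)) => // [|q].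
    by apply: ball1_cst; rewrite a1.
  rewrite subr0; apply: (inverse_ball _ _ FG _ _).2.
  by apply: ball1_cst; rewrite a1.
have := h 1 (normr1 _); have := h (-1) (normrN1 _); rewrite !ler_norml; lra.
Qed.

Lemma half_dist_eq (a b : R) : `|a| = 1 -> `|b| <= 1 / 2 -> `|a - b| <= 1 / 2 -> b = a / 2.
Proof. by move/norm1P => [->|->]; rewrite !ler_norml; lra. Qed.

(** If [|y t| < 1], then [y / 2] can be perturbed at [t] while staying within 1/2 of both 0 and [y].
    The images are then within 1/2 of both 0 and [e], so all equal [e / 2], against injectivity. *)
Lemma norm_inverse_sign_isolated e t : sign_function e -> open [set t] -> `|G e t| = 1.
Proof.
move=> se ot; have be := ball1_sign _ se; have [cy y1] := inverse_ball _ _ FG _ be.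
set y := G e in cy y1 *.
apply/eqP; rewrite eq_le y1 leNgt; apply/negP => yt.
pose z (l : R) := upd (fun p => 2^-1 * y p + 0 * y p) t (y t / 2 + l).
have bz l : 0 <= l -> l <= (1 - `|y t|) / 2 ->
    (forall p, `|z l p| <= 1 / 2) /\ (forall p, `|y p - z l p| <= 1 / 2).
  move=> l0 l1; have yt' : y t <= `|y t| := ler_norm _.
  have yt'' : - y t <= `|y t| by rewrite -normrN ler_norm.
  rewrite /z; split=> p; (have [->|/eqP pt] := eqVneq p t; [rewrite updE|rewrite updN//]).
  - by rewrite ler_norml; lra.
  - by move: (y1 p); rewrite !ler_norml; lra.
  - by rewrite ler_norml; lra.
  - by move: (y1 p); rewrite !ler_norml; lra.
have b1 l : 0 <= l -> l <= (1 - `|y t|) / 2 -> ball1 (z l).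
  move=> l0 l1; split=> [|p]; last by have [/(_ p) + _] := bz l l0 l1; lra.
  by apply: continuous_upd => //; exact: continuous_lincomb.
have Fz l : 0 <= l -> l <= (1 - `|y t|) / 2 -> F (z l) = fun p => e p / 2.
  move=> l0 l1; apply/funext => p; apply: half_dist_eq; first exact: se.2.
    have := contractionP _ _ FG (z l) (fun=> 0) (b1 _ l0 l1).
    rewrite contraction0 => /(_ (ball1_cst 0 _) (1 / 2)); rewrite normr0 => /(_ ler01).
    move=> /(_ _ p); rewrite subr0; apply => q; rewrite subr0.
    exact: (bz _ l0 l1).1.
  by apply: (dist_inverse e) => //; [exact: b1|exact: (bz _ l0 l1).2].
pose l0 := (1 - `|y t|) / 2.
have l00 : 0 < l0 by rewrite /l0; lra.
have : z 0 = z l0.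
  by apply: contraction_inj; [apply: b1; lra|apply: b1; rewrite /l0; lra|rewrite !Fz//; rewrite /l0; lra].
by move=> /(congr1 (fun h => h t)); rewrite /z !updE; lra.
Qed.

Lemma sign_function_inverse e : sign_function e -> sign_function (G e).
Proof.
move=> se; have [cy y1] := inverse_ball _ _ FG _ (ball1_sign _ se).
split=> // p; apply/eqP; rewrite eq_le y1/=.
apply: (@isolated_dense_le (fun=> 1) (fun p => `|G e p|)).
- exact: cst_continuous.
- by move=> q; apply: cvg_norm; exact: cy.
- by move=> k ok; rewrite norm_inverse_sign_isolated.
Qed.

Lemma ball1_spike t a : open [set t] -> `|a| <= 1 -> ball1 (upd (fun=> 0) t a).
Proof. by move=> ot a1; apply: ball1_upd => //; apply: ball1_cst; rewrite normr0. Qed.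

Lemma contraction_spike_neq0 t a : open [set t] -> `|a| <= 1 -> a <> 0 ->
  F (upd (fun=> 0) t a) <> (fun=> 0).
Proof.
move=> ot a1 a0; move=> F0.
have : upd (fun=> 0) t a = (fun=> 0).
  apply: contraction_inj; [exact: ball1_spike|by apply: ball1_cst; rewrite normr0|].
  by rewrite F0 contraction0.
by move=> /(congr1 (fun h => h t)); rewrite updE => /a0.
Qed.

(** When [a] and [G u t] do not have opposite signs, the spike of height [a] at [t] lies within 1 of
    [G u]. *)
Lemma spike_dist u t a p : ball1 u -> open [set t] -> `|a| <= 1 ->
  0 <= a * G u t -> `|u p - F (upd (fun=> 0) t a) p| <= 1.
Proof.
move=> bu ot a1 au; apply: dist_inverse => //; first exact: ball1_spike.
have [_ G1] := inverse_ball _ _ FG _ bu.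
move=> q; have [->|/eqP pt] := eqVneq q t; last by rewrite updN// subr0.
rewrite updE; move: (G1 t) a1 au; rewrite !ler_norml; nra.
Qed.

(** If the two values agreed, the image of the spike with that value at [t] would be within 1 of
    both [e] and [- e], hence zero, against injectivity. *)
Lemma inverse_signN e t : sign_function e -> open [set t] ->
  G (fun p => - e p) t = - G e t.
Proof.
move=> se ot; have seN := sign_functionN _ se.
have [be beN] := (ball1_sign _ se, ball1_sign _ seN).
have := norm_inverse_sign_isolated _ _ se ot; have := norm_inverse_sign_isolated _ _ seN ot.
have [->|yy] := pselect (G (fun p => - e p) t = - G e t) => // yN1 y1.
have Gt : G (fun p => - e p) t = G e t.
  by move: yy; case/norm1P: y1 => ->; case/norm1P: yN1 => ->; rewrite ?opprK.
have y0 : G e t <> 0 by move=> y0; move: y1; rewrite y0 normr0; lra.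
have y1' : `|G e t| <= 1 by rewrite y1.
case: (contraction_spike_neq0 t (G e t) ot y1' y0); apply/funext => p.
have h1 : `|e p - F (upd (fun=> 0) t (G e t)) p| <= 1.
  by apply: spike_dist => //; rewrite -expr2 sqr_ge0.
have h2 : `|- e p - F (upd (fun=> 0) t (G e t)) p| <= 1.
  by apply: (spike_dist (fun p => - e p)) => //; rewrite Gt -expr2 sqr_ge0.
move: h1 h2 (se.2 p); rewrite !ler_norml => h1 h2 /norm1P[] ep; rewrite ep in h1 h2; lra.
Qed.

Definition linked t k (th : R) := forall a, `|a| <= 1 ->
  (forall p, p <> k -> F (upd (fun=> 0) t a) p = 0) /\
  0 <= th * a * F (upd (fun=> 0) t a) k.

Let one : K -> R := fun=> 1.

(** Up to a sign, [one] and its flip at [k] both have an inverse image whose sign at [t] matches the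
    spike, so both lie within 1 of the image of the spike. With these signs they are opposite off
    [k] and equal at [k]: the image vanishes off [k] and has a known sign at [k]. *)
Lemma linked_flip t k : open [set t] -> open [set k] ->
  G one t <> G (upd one k (-1)) t -> linked t k (G one t).
Proof.
move=> ot ok yy a a1.
have s1 : sign_function one by apply: sign_function_cst; rewrite normr1.
have s2 : sign_function (upd one k (-1)) by apply: sign_function_upd => //; rewrite normrN1.
have [b1 b2] := (ball1_sign _ s1, ball1_sign _ s2).
have [b1N b2N] := (ball1_sign _ (sign_functionN _ s1), ball1_sign _ (sign_functionN _ s2)).
have e1 := inverse_signN _ _ s1 ot; have e2 := inverse_signN _ _ s2 ot.
have n1 := norm_inverse_sign_isolated _ _ s1 ot.
have n2 := norm_inverse_sign_isolated _ _ s2 ot.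
have y12 : G (upd one k (-1)) t = - G one t.
  by case/norm1P: n1 yy => ->; case/norm1P: n2 => ->; rewrite ?opprK.
have [ya|ya] := leP 0 (a * G one t).
  have h1 p := spike_dist one t a p b1 ot a1 ya.
  have ya2 : 0 <= a * G (fun p => - upd one k (-1) p) t by rewrite e2 y12 opprK.
  have h2 p := spike_dist _ t a p b2N ot a1 ya2.
  split=> [p pk|].
    by move: (h1 p) (h2 p); rewrite [upd one _ _ p]updN// !ler_norml /one; lra.
  by move: (h1 k) ya; rewrite ler_norml /one => h {}ya; rewrite (mulrC _ a) mulr_ge0//; lra.
have ya1 : 0 <= a * G (fun p => - one p) t by rewrite e1; nra.
have h1 p := spike_dist _ t a p b1N ot a1 ya1.
have ya2 : 0 <= a * G (upd one k (-1)) t by rewrite y12; nra.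
have h2 p := spike_dist _ t a p b2 ot a1 ya2.
split=> [p pk|].
  by move: (h1 p) (h2 p); rewrite [upd one _ _ p]updN// !ler_norml /one; lra.
by move: (h1 k); rewrite ler_norml /one => h; nra.
Qed.

Lemma linked_neq0 t k th a : open [set t] -> linked t k th ->
  `|a| <= 1 -> a <> 0 -> F (upd (fun=> 0) t a) k <> 0.
Proof.
move=> ot lk a1 a0 Fk; case: (contraction_spike_neq0 t a ot a1 a0).
apply/funext => p; have [->|/eqP pk] := eqVneq p k => //.
exact: (lk a a1).1.
Qed.

(** Otherwise a small spike in the direction opposite to [th * u k] stays within 1 of [G u], while
    its image at [k] is nonzero with sign opposite to [u k], hence more than 1 away from [u k]. *)
Lemma linked_value t k th u : open [set t] -> linked t k th -> `|th| = 1 ->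
  ball1 u -> `|u k| = 1 -> G u t = th * u k.
Proof.
move=> ot lk th1 bu uk.
have [_ G1] := inverse_ball _ _ FG _ bu.
have key l : 0 < l -> l <= 1 -> 1 - l <= G u t * (th * u k).
  move=> l0 l1; rewrite leNgt; apply/negP => Gl.
  pose a := - l * (th * u k).
  have na : `|a| = l by rewrite /a !normrM th1 uk normrN gtr0_norm// !mulr1.
  have a1 : `|a| <= 1 by rewrite na.
  have a0 : a <> 0 by move=> a0; move: na; rewrite a0 normr0; lra.
  have nz := linked_neq0 _ _ _ _ ot lk a1 a0; have [_ sg] := lk a a1.
  suff h : `|u k - F (upd (fun=> 0) t a) k| <= 1.
    move: h nz sg; rewrite /a; set c := F _ _.
    case/norm1P: th1 => ->; case/norm1P: uk => -> h nz sg; apply: nz; move: h sg; rewrite ler_norml; nra.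
  apply: dist_inverse => //; first exact: ball1_spike.
  move=> q; have [->|/eqP pt] := eqVneq q t; last by rewrite updN// subr0.
  rewrite updE; move: Gl (G1 t); rewrite /a !ler_norml.
  by case/norm1P: th1 => ->; case/norm1P: uk => ->; lra.
have : 1 <= G u t * (th * u k).
  rewrite leNgt; apply/negP => h.
  pose l := Num.min 1 ((1 - G u t * (th * u k)) / 2).
  have l0 : 0 < l by rewrite /l lt_min; lra.
  have l1 : l <= 1 by rewrite /l ge_min lexx.
  have l2 : l <= (1 - G u t * (th * u k)) / 2 by rewrite /l ge_min lexx orbT.
  by have := key l l0 l1; lra.
move: (G1 t); rewrite ler_norml.
by case/norm1P: th1 => ->; case/norm1P: uk => ->; lra.
Qed.

(** Any isolated [k] where the image of the unit spike is nonzero works: if [u k] is more than 1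
    away from that image, then [G u t < 0]. Two such [u], equal to [one] and to its flip up to
    signs, show that flipping [one] at [k] changes the sign at [t]. *)
Lemma exists_linked t : open [set t] ->
  exists k, open [set k] /\ linked t k (G one t).
Proof.
move=> ot.
have n1 : `|1 : R| <= 1 by rewrite normr1.
set z := upd (fun=> 0) t (1 : R).
have [k [ok Fk]] : exists k, open [set k] /\ F z k <> 0.
  have z0 : (1 : R) <> 0 by apply/eqP; rewrite oner_eq0.
  apply: contrapT => nex; apply: (contraction_spike_neq0 t 1 ot n1 z0).
  apply: isolated_dense_eq; [|exact: cst_continuous|].
    exact: (contraction_ball _ _ FG _ (ball1_spike _ _ ot n1)).1.
  by move=> k ok; apply: contrapT => Fk; apply: nex; exists k.
exists k; split=> //; apply: linked_flip => //.
have s1 : sign_function one by apply: sign_function_cst; rewrite normr1.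
have s2 : sign_function (upd one k (-1)) by apply: sign_function_upd => //; rewrite normrN1.
have neg u : ball1 u -> 1 < `|u k - F z k| -> G u t < 0.
  move=> bu uk; rewrite ltNge; apply/negP => Gu; move: uk; rewrite ltNge => /negP; apply.
  by apply: spike_dist => //; rewrite mul1r.
have e1 := inverse_signN _ _ s1 ot; have e2 := inverse_signN _ _ s2 ot.
have [Fn|Fp|//] := ltgtP (F z k) 0.
  have h1 : G one t < 0.
    by apply: neg; [exact: ball1_sign|rewrite /one gtr0_norm; lra].
  have h2 : G (fun p => - upd one k (-1) p) t < 0.
    by apply: neg; [exact/ball1_sign/sign_functionN|rewrite updE gtr0_norm; lra].
  lra.
have h1 : G (fun p => - one p) t < 0.
  by apply: neg; [exact/ball1_sign/sign_functionN|rewrite /one ltr0_norm; lra].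
have h2 : G (upd one k (-1)) t < 0.
  by apply: neg; [exact/ball1_sign|rewrite updE ltr0_norm; lra].
lra.
Qed.

(** Images of spikes at [t] and [t'] are determined by their value at [k]. Along the spikes at [t']
    this value runs continuously from 0, so by intermediate values it meets the value for [t],
    against injectivity. *)
Lemma linked_inj t t' k th th' : open [set t] -> open [set t'] ->
  `|th| = 1 -> `|th'| = 1 -> linked t k th -> linked t' k th' -> t = t'.
Proof.
wlog le : t t' th th' / F (upd (fun=> 0) t th) k <= F (upd (fun=> 0) t' th') k.
  move=> wl ot ot' h h' l l'.
  have [le|/ltW le] := leP (F (upd (fun=> 0) t th) k) (F (upd (fun=> 0) t' th') k).
    exact: wl le ot ot' h h' l l'.
  exact/esym/(wl _ _ _ _ le ot' ot h' h l' l).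
move=> ot ot' h h' l l'.
have b (s : R) : `|clamp s * th'| <= 1.
  by have := clampP s; rewrite normrM h' mulr1 => ?; rewrite ger0_norm; lra.
pose q s := F (upd (fun=> 0) t' (clamp s * th')) k.
have qlip s s' : `|q s - q s'| <= `|s - s'|.
  apply: (contractionP _ _ FG); [exact: ball1_spike|exact: ball1_spike|].
  move=> p; have [->|/eqP pt] := eqVneq p t'.
    rewrite !updE -mulrBl normrM h' mulr1; exact: clamp_dist.
  by rewrite !updN// subrr normr0.
have cq : continuous q.
  move=> s; apply/cvgrPdist_lt => eps eps0; near=> s'.
  apply: le_lt_trans (qlip _ _) _; near: s'.
  by move: eps eps0; apply/cvgrPdist_lt; exact: cvg_id.
have th1 : `|th| <= 1 by rewrite h.
have pos : 0 <= F (upd (fun=> 0) t th) k.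
  have [_] := l th th1; case/norm1P: h => ->; lra.
have q0 : q 0 = 0.
  rewrite /q clamp_id// mul0r.
  suff -> : upd (fun=> 0) t' 0 = (fun=> 0) :> (K -> R) by rewrite contraction0.
  by apply/funext => p; rewrite /upd; case: ifP.
have q1 : q 1 = F (upd (fun=> 0) t' th') k.
  by rewrite /q clamp_id ?mul1r// ler01.
have [||s _ qs] := @IVT R q 0 1 (F (upd (fun=> 0) t th) k) ler01.
- exact: continuous_subspaceT.
- by rewrite q0 q1 ge_min le_max pos le orbT.
apply: contrapT => tt'.
have : upd (fun=> 0) t' (clamp s * th') = upd (fun=> 0) t th :> (K -> R).
  apply: contraction_inj; [exact: ball1_spike|exact: ball1_spike|].
  apply/funext => p; have [->//|/eqP pk] := eqVneq p k.
  by rewrite (l' _ (b s)).1// (l _ th1).1.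
move=> /(congr1 (fun f => f t)); rewrite updE updN// => th0.
by move: h; rewrite -th0 normr0; lra.
Unshelve. all: by end_near. Qed.

End Pair.

Lemma real_clopen_setT (A : set R) : open A -> open (~` A) -> A !=set0 -> A = setT.
Proof.
move=> oA oCA A0.
have /connected_intervalP cT : is_interval [set: R] by [].
apply: cT => //; first by exists A; rewrite ?setTI.
by exists A; rewrite ?setTI// -openC.
Qed.

(** * Values of the inverse on faces of the ball *)

Definition face_weights (sg : K -> K) (th : K -> R) G :=
  forall t, open [set t] -> forall u, ball1 u -> `|u (sg t)| = 1 ->
    G u t = th t * u (sg t).

Lemma exists_face_weights F G : contraction_pair F G ->
  exists (sg : K -> K) (th : K -> R),
  [/\ forall t, open [set t] -> open [set sg t],
      forall t, open [set t] -> `|th t| = 1,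
      forall t t', open [set t] -> open [set t'] -> sg t = sg t' -> t = t' &
      face_weights sg th G].
Proof.
move=> FG.
have /choice[sg sgP] : forall t, exists k, open [set t] ->
    open [set k] /\ linked F t k (G (fun=> 1) t).
  (* At a non-isolated point the value is a dummy. *)
  move=> t; have [ot|not] := pselect (open [set t]); last by exists t.
  by have [k kP] := exists_linked _ _ FG _ ot; exists k.
have s1 : sign_function (fun=> 1) by apply: sign_function_cst; rewrite normr1.
have th1 t : open [set t] -> `|G (fun=> 1) t| = 1.
  by move=> ot; exact: norm_inverse_sign_isolated FG _ _ s1 ot.
exists sg, (G (fun=> 1)); split=> //.
- by move=> t /sgP[].
- move=> t t' ot ot' st; have [_ l] := sgP _ ot; have [_ l'] := sgP _ ot'.
  rewrite -st in l'.
  exact: linked_inj FG _ _ _ _ _ ot ot' (th1 _ ot) (th1 _ ot') l l'.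
- move=> t ot u bu uk; have [_ l] := sgP _ ot.
  exact: linked_value FG _ _ _ _ ot l (th1 _ ot) bu uk.
Qed.

Section Weights.
Variables (sg : K -> K) (th : K -> R).
Hypothesis open_sg : forall t, open [set t] -> open [set sg t].
Hypothesis norm_th : forall t, open [set t] -> `|th t| = 1.
Hypothesis sg_inj : forall t t', open [set t] -> open [set t'] ->
  sg t = sg t' -> t = t'.

(** * Orthants and rescaling *)

Section Orthant.
Variables (F G : (K -> R) -> (K -> R)) (e : K -> R).
Hypotheses (FG : contraction_pair F G) (GW : face_weights sg th G).
Hypothesis se : sign_function e.

Let y := G e.

Lemma inverse_signE t : open [set t] -> y t = th t * e (sg t).
Proof. by move=> ot; apply: GW => //; [exact: ball1_sign|exact: se.2]. Qed.

Lemma inverse_flip t : open [set t] ->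
  let v := upd e (sg t) (- e (sg t)) in
  [/\ sign_function v, G v t = - y t &
      forall t', open [set t'] -> t' <> t -> G v t' = y t'].
Proof.
move=> ot v; have sv : sign_function v.
  by apply: sign_function_upd; rewrite ?normrN ?se.2//; exact: open_sg.
have Gv t' : open [set t'] -> G v t' = th t' * v (sg t').
  by move=> ot'; apply: GW => //; [exact: ball1_sign|exact: sv.2].
split=> //; first by rewrite Gv// /v updE mulrN inverse_signE.
move=> t' ot' tt'; rewrite Gv// /v updN ?inverse_signE//.
by move=> /(sg_inj _ _ ot' ot).
Qed.

(** Within the ball, the orthant of a sign function consists of the points at distance at most 1
    from it. *)
Lemma orthant_contraction z : ball1 z -> (forall p, 0 <= z p * y p) ->
  forall p, 0 <= F z p * e p.
Proof.
move=> bz zy p; have [_ y1] := sign_function_inverse _ _ FG _ se.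
have : `|e p - F z p| <= 1.
  apply: (dist_inverse _ _ FG) => //; first exact: ball1_sign.
  move=> q; move: (zy q) (bz.2 q); rewrite /y !ler_norml.
  by case/norm1P: (y1 q) => ->; lra.
by rewrite ler_norml; case/norm1P: (se.2 p) => ->; lra.
Qed.

(** Flipping [e] at [sg t] gives [v] at distance at least [1 + d] from [u], while [G v] is at
    distance at most [1 + G u t * y t] from [G u]. This self-improvement supplies openness in the
    continuity argument that follows. *)
Lemma orthant_inverse_gap u (d : R) : ball1 u -> (forall p, d <= u p * e p) ->
  (forall p, 0 <= G u p * y p) -> forall p, d <= G u p * y p.
Proof.
move=> bu ue xy.
have [cx x1] := inverse_ball _ _ FG _ bu.
have [cy y1] := sign_function_inverse _ _ FG _ se.
apply: isolated_dense_le; first exact: cst_continuous.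
  by move=> p; apply: cvgM; [exact: cx|exact: cy].
move=> t ot; have [sv vt vN] := inverse_flip _ ot; set v := upd _ _ _ in sv vt vN.
have bv := ball1_sign _ sv.
have : `|v (sg t) - F (G u) (sg t)| <= 1 + G u t * y t.
  apply: (dist_inverse _ _ FG v (G u)) => //.
  apply: isolated_dense_dist => //; first exact: (inverse_ball _ _ FG _ bv).1.
  move=> t' ot'; have [->|/eqP tt'] := eqVneq t' t.
    move: (xy t); rewrite vt ler_norml /y.
    by case/norm1P: (y1 t) => ->; lra.
  move: (xy t') (xy t) (x1 t'); rewrite vN// !ler_norml /y.
  by case/norm1P: (y1 t') => ->; lra.
rewrite (inverseK _ _ FG)// /v updE ler_norml; move: (ue (sg t)).
by case/norm1P: (se.2 (sg t)) => ->; lra.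
Qed.

Lemma ball1_lincomb f g (a b : R) : 0 <= a -> 0 <= b -> a + b <= 1 ->
  ball1 f -> ball1 g -> ball1 (fun p => a * f p + b * g p).
Proof.
move=> a0 b0 ab [cf f1] [cg g1]; split=> [|p]; first exact: continuous_lincomb.
apply: le_trans (ler_normD _ _) _; rewrite !normrM (ger0_norm a0) (ger0_norm b0).
by apply: le_trans ab; apply: lerD; rewrite ler_piMr.
Qed.

(** Along the segment from [e] to [u], having an inverse image in the orthant of [y] is a closed
    condition by continuity of [G], and an open one by the gap [d]; the line is connected. *)
Lemma orthant_inverse_pos u (d : R) : ball1 u -> 0 < d ->
  (forall p, d <= u p * e p) -> forall p, 0 <= G u p * y p.
Proof.
move=> bu d0 ue.
have be := ball1_sign _ se.
have [cy y1] := sign_function_inverse _ _ FG _ se.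
have yy p : y p * y p = 1 by rewrite /y; case/norm1P: (y1 p) => ->; lra.
have ee p : e p * e p = 1 by case/norm1P: (se.2 p) => ->; lra.
pose c (s : R) := fun p => (1 - clamp s) * e p + clamp s * u p.
have bc s : ball1 (c s) by apply: ball1_lincomb => //; have := clampP s; lra.
have ce s p : d <= c s p * e p.
  have ue1 : u p * e p <= 1.
    by move: (bu.2 p); rewrite ler_norml; case/norm1P: (se.2 p) => ->; lra.
  have := clampP s; have := ue p; have := ee p; rewrite /c; nra.
have cd s s' p : `|c s p - c s' p| <= 2 * `|s - s'|.
  have -> : c s p - c s' p = (clamp s - clamp s') * (u p - e p) by rewrite /c; lra.
  rewrite normrM mulrC; apply: ler_pM => //; last exact: clamp_dist.
  by apply: le_trans (ler_normB _ _) _; have := bu.2 p; rewrite se.2; lra.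
have near_c s eps : 0 < eps -> \forall s' \near s,
    forall p, `|G (c s) p - G (c s') p| <= eps.
  move=> eps0; have [r r0 rP] := inverse_continuous _ _ FG _ (bc s) _ eps0.
  have r2 : 0 < r / 2 by lra.
  have : \forall s' \near s, `|s - s'| < r / 2.
    have h : s' @[s' --> s] --> s by exact: cvg_id.
    by move/cvgrPdist_lt: h; apply.
  apply: filterS => s' ss'; apply: rP => // p.
  by apply: le_trans (cd _ _ _) _; lra.
pose A := [set s | forall p, 0 <= G (c s) p * y p].
have c1 : c 1 = u by apply/funext => p; rewrite /c clamp_id ?ler01//; lra.
rewrite -c1; suff AT : A = setT by have : A 1 by rewrite AT.
apply: real_clopen_setT.
- rewrite openE => s sA.
  have gap := orthant_inverse_gap _ _ (bc s) (ce s) sA.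
  apply: filterS (near_c s d d0) => s' h p.
  move: (gap p) (h p); rewrite ler_norml /y; case/norm1P: (y1 p) => ->; lra.
- rewrite openE => s /= /existsNP[p /negP]; rewrite -ltNge => neg.
  have eps0 : 0 < - (G (c s) p * y p) / 2 by lra.
  apply: filterS (near_c s _ eps0) => s' h /(_ p).
  move: (h p) neg; rewrite ler_norml /y; case/norm1P: (y1 p) => ->; lra.
- exists 0 => p; have -> : c 0 = e by apply/funext => q; rewrite /c clamp_id ?ler01//; lra.
  by rewrite yy.
Qed.

(** Moving [u] slightly towards [e] reduces this to a positive gap, by continuity of [G]. *)
Lemma orthant_inverse u : ball1 u -> (forall p, 0 <= u p * e p) ->
  forall p, 0 <= G u p * y p.
Proof.
move=> bu ue p; rewrite leNgt; apply/negP => neg.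
have be := ball1_sign _ se; have [_ y1] := sign_function_inverse _ _ FG _ se.
have eps0 : 0 < - (G u p * y p) / 2 by lra.
have [r r0 rP] := inverse_continuous _ _ FG _ bu _ eps0.
(* The function [v] gets the gap [s] and stays within [2 * s <= r] of [u]. *)
pose s := Num.min 1 (r / 2).
have s0 : 0 < s by rewrite /s lt_min; lra.
have s1 : s <= 1 by rewrite /s ge_min lexx.
have sr : s <= r / 2 by rewrite /s ge_min lexx orbT.
pose v := fun q => (1 - s) * u q + s * e q.
have bv : ball1 v by apply: ball1_lincomb => //; lra.
have ve q : s <= v q * e q.
  have ee : e q * e q = 1 by case/norm1P: (se.2 q) => ->; lra.
  by have := ue q; rewrite /v; nra.
have := orthant_inverse_pos _ _ bv s0 ve p.
have : `|G u p - G v p| <= - (G u p * y p) / 2.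
  apply: rP => // q.
  have -> : u q - v q = s * (u q - e q) by rewrite /v; lra.
  rewrite normrM (gtr0_norm s0).
  have : `|u q - e q| <= 2.
    by apply: le_trans (ler_normB _ _) _; have := bu.2 q; rewrite se.2; lra.
  nra.
rewrite ler_norml; move: neg; rewrite /y; case/norm1P: (y1 p) => ->; lra.
Qed.

Let avg f g : K -> R := fun p => 2^-1 * f p + 2^-1 * g p.

(** [F] and [G] conjugated by the homotheties from the unit ball onto the balls of radius 1/2 around
    [y / 2] and [e / 2]. *)
Let Fe z : K -> R := fun p => 2 * F (avg y z) p + (-1) * e p.
Let Ge u : K -> R := fun p => 2 * G (avg e u) p + (-1) * y p.

Lemma ball1_avg f g : ball1 f -> ball1 g -> ball1 (avg f g).
Proof. by move=> bf bg; apply: ball1_lincomb => //; lra. Qed.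

Lemma avg_sign e' u : sign_function e' -> ball1 u -> forall p, 0 <= avg e' u p * e' p.
Proof.
move=> se' bu p; move: (bu.2 p); rewrite ler_norml /avg.
by case/norm1P: (se'.2 p) => ->; lra.
Qed.

Lemma orthant_pair : contraction_pair Fe Ge.
Proof.
have be := ball1_sign _ se; have sy := sign_function_inverse _ _ FG _ se.
have by_ := ball1_sign _ sy.
have dbl e' f : sign_function e' -> ball1 f -> (forall p, 0 <= f p * e' p) ->
    ball1 (fun p => 2 * f p + (-1) * e' p).
  move=> [ce' se'] [cf f1] fe; split=> [|p]; first exact: continuous_lincomb.
  by move: (f1 p) (fe p); rewrite !ler_norml; case/norm1P: (se' p) => ->; lra.
have bF z : ball1 z -> ball1 (F (avg y z)) /\ forall p, 0 <= F (avg y z) p * e p.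
  move=> bz; have ba := ball1_avg _ _ by_ bz; split; first exact: contraction_ball _ _ FG _ ba.
  by apply: orthant_contraction => //; exact: avg_sign.
have bG u : ball1 u -> ball1 (G (avg e u)) /\ forall p, 0 <= G (avg e u) p * y p.
  move=> bu; have ba := ball1_avg _ _ be bu; split; first exact: inverse_ball _ _ FG _ ba.
  by apply: orthant_inverse => //; exact: avg_sign.
split.
- by move=> z /bF[? ?]; exact: dbl.
- by move=> u /bG[? ?]; exact: dbl.
- move=> z bz; apply/funext => p.
  have avgE : avg e (Fe z) = F (avg y z) by apply/funext => q; rewrite /avg /Fe; lra.
  by rewrite /Ge avgE (contractionK _ _ FG) /avg; [lra|exact: ball1_avg].
- move=> u bu; apply/funext => p.
  have avgE : avg y (Ge u) = G (avg e u) by apply/funext => q; rewrite /avg /Ge; lra.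
  by rewrite /Fe avgE (inverseK _ _ FG) /avg; [lra|exact: ball1_avg].
- move=> f g bf bg r fg p.
  have : `|F (avg y f) p - F (avg y g) p| <= r / 2.
    apply: (contractionP _ _ FG); [exact: ball1_avg|exact: ball1_avg|].
    by move=> q; have := fg q; rewrite /avg !ler_norml; lra.
  by rewrite /Fe !ler_norml; lra.
- move=> f bf eps eps0.
  have eps2 : 0 < eps / 2 by lra.
  have [d d0 dP] := inverse_continuous _ _ FG _ (ball1_avg _ _ be bf) _ eps2.
  exists d => // g bg fg p.
  have : `|G (avg e f) p - G (avg e g) p| <= eps / 2.
    apply: dP => [|q]; first exact: ball1_avg.
    have := fg q; rewrite /avg !ler_norml; lra.
  by rewrite /Ge !ler_norml; lra.
Qed.

(* Moving [y / 2] outwards at [t] moves its image [e / 2] outwards at [sg t]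
   only, by injectivity; comparing with this point forces [G w t = 0]. *)
Lemma orthant_inverse_zero w t : ball1 w -> (forall p, 0 <= w p * e p) ->
  open [set t] -> w (sg t) = 0 -> G w t = 0.
Proof.
move=> bw we ot wk; have be := ball1_sign _ se.
have sy := sign_function_inverse _ _ FG _ se; have by_ := ball1_sign _ sy.
have [cy y1] := sy.
have xy := orthant_inverse _ bw we.
have [_ x1] := inverse_ball _ _ FG _ bw.
suff : G w t * y t <= 0.
  by move: (xy t); rewrite /y; case/norm1P: (y1 t) => ->; lra.
rewrite leNgt; apply/negP => pos.
pose z l := upd (avg y (fun=> 0)) t ((1 / 2 + l) * y t).
have b0 : ball1 (fun=> 0) by apply: ball1_cst; rewrite normr0.
have bz l : 0 <= l -> l <= 1 / 2 -> ball1 (z l).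
  move=> l0 l1; apply: ball1_upd => //; first exact: ball1_avg.
  by rewrite normrM y1 mulr1 ger0_norm; lra.
have lowF l p : 0 <= l -> l <= 1 / 2 -> 1 / 2 <= F (z l) p * e p.
  move=> l0 l1; have : `|e p - F (z l) p| <= 1 / 2.
    apply: (dist_inverse _ _ FG) => //; first exact: bz.
    move=> q; rewrite /z; have [->|/eqP qt] := eqVneq q t.
      by rewrite updE ler_norml /y; case/norm1P: (y1 t) => ->; lra.
    by rewrite updN// /avg ler_norml /y; case/norm1P: (y1 q) => ->; lra.
  by rewrite ler_norml; case/norm1P: (se.2 p) => ->; lra.
(* Being within 3/2 of [e] flipped at [i] gives the upper bound that matches [lowF]. *)
have upF l i : 0 <= l -> l <= 1 / 2 -> open [set i] -> i <> sg t \/ l = 0 ->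
    F (z l) i = e i / 2.
  move=> l0 l1 oi il; have low := lowF l i l0 l1.
  pose v := upd e i (- e i).
  have sv : sign_function v by apply: sign_function_upd; rewrite ?normrN ?se.2.
  have bv := ball1_sign _ sv.
  have [_ Gv1] := inverse_ball _ _ FG _ bv.
  have : `|v i - F (z l) i| <= 3 / 2.
    apply: (dist_inverse _ _ FG) => //; first exact: bz.
    move=> q; rewrite /z; have [->|/eqP qt] := eqVneq q t; last first.
      rewrite updN// /avg; move: (Gv1 q); rewrite !ler_norml /y.
      by case/norm1P: (y1 q) => ->; lra.
    rewrite updE; case: il => [ik|->]; last first.
      by move: (Gv1 t); rewrite !ler_norml /y; case/norm1P: (y1 t) => ->; lra.
    have -> : G v t = y t.
      rewrite inverse_signE// GW//; last exact: sv.2.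
      by rewrite /v updN// => ki; apply: ik.
    by rewrite ler_norml /y; case/norm1P: (y1 t) => ->; lra.
  by move: low; rewrite /v updE ler_norml; case/norm1P: (se.2 i) => ->; lra.
(* The bound 1/2 keeps [z l] in the ball; the other keeps it within 1/2 of [G w] at [t]. *)
pose l := Num.min (1 / 2) (G w t * y t).
have l0 : 0 < l by rewrite /l lt_min pos; lra.
have l1 : l <= 1 / 2 by rewrite /l ge_min lexx.
have l2 : l <= G w t * y t by rewrite /l ge_min lexx orbT.
have ok := open_sg _ ot.
have half0 : 0 <= 1 / 2 :> R by lra.
have [eqk|nek] := pselect (F (z l) (sg t) = e (sg t) / 2).
  have : z l = z 0.
    apply: (contraction_inj _ _ FG); [by apply: bz => //; lra|exact: bz|].
    apply: isolated_dense_eq.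
    - by apply: (contraction_ball _ _ FG _ _).1; apply: bz => //; lra.
    - by apply: (contraction_ball _ _ FG _ _).1; exact: bz.
    - move=> i oi; rewrite (upF 0 i)//; last by right.
      have [->//|/eqP ik] := eqVneq i (sg t).
      by apply: upF => //; [lra|left].
  move=> /(congr1 (fun f => f t)); rewrite /z !updE /y.
  by case/norm1P: (y1 t) => ->; lra.
have := lowF l (sg t) (ltW l0) l1.
have : `|w (sg t) - F (z l) (sg t)| <= 1 / 2.
  apply: (dist_inverse _ _ FG) => //; first by apply: bz => //; lra.
  move=> q; rewrite /z; have [->|/eqP qt] := eqVneq q t.
    move: l2 (x1 t); rewrite updE !ler_norml /y; case/norm1P: (y1 t) => ->; lra.
  move: (xy q) (x1 q); rewrite updN// /avg !ler_norml /y; case/norm1P: (y1 q) => ->; lra.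
rewrite wk ler_norml; move: nek; case/norm1P: (se.2 (sg t)) => ->; lra.
Qed.

(** If [u] equals [e] at [sg t], the average has modulus 1 there and the weights of [G] apply; if it
    equals [- e], the average vanishes there and [orthant_inverse_zero] applies. *)
Lemma orthant_face_weights : face_weights sg th Ge.
Proof.
move=> t ot u bu uk; have be := ball1_sign _ se.
have ba := ball1_avg _ _ be bu.
have ye := inverse_signE _ ot.
have [ue|ue] : u (sg t) = e (sg t) \/ u (sg t) = - e (sg t).
  by case/norm1P: uk => ->; case/norm1P: (se.2 (sg t)) => ->; rewrite ?opprK; [left|right|right|left].
- rewrite /Ge GW// /avg ue; first by rewrite -/y ye; lra.
  by rewrite -mulrDl [_ + _](_ : _ = 1) ?mul1r ?se.2//; lra.
- rewrite /Ge orthant_inverse_zero//; first by rewrite ye ue; lra.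
  + exact: avg_sign.
  + by rewrite /avg ue; lra.
Qed.

End Orthant.

(** * Clopen approximation and iteration *)

Hypotheses (hcpt : compact [set: K]) (h0 : clopen_basis K).

(* The filter generated by the complements in [{u >= 0}] of the clopen subsets
   of [{u > -d}] has no cluster point, hence it is not proper. *)
Lemma clopen_separation u (d : R) : continuous u -> 0 < d ->
  exists V : set K, [/\ clopen V, V `<=` [set p | - d < u p] & [set p | 0 <= u p] `<=` V].
Proof.
move=> cu d0; apply: contrapT => nV.
pose P := [set p | 0 <= u p].
pose D := [set V : set K | clopen V /\ V `<=` [set p | - d < u p]].
pose Phi : set_system K := filter_from D (fun V => P `\` V).
have FPhi : ProperFilter Phi.
  apply: filter_from_proper; first apply: filter_from_filter.
  - by exists set0; split=> //; exact: clopen0.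
  - move=> V W [[oV cV] sV] [[oW cW] sW]; exists (V `|` W).
      by split; [split; [exact: openU|exact: closedU]|move=> p [/sV|/sW]].
    by move=> p [Pp nVW]; split; split=> // ?; apply: nVW; [left|right].
  - move=> V [cV sV]; apply: contrapT => VP; apply: nV; exists V; split=> //.
    by move=> p Pp; apply: contrapT => nVp; apply: VP; exists p.
have [p [_ clp]] := hcpt _ FPhi filterT.
have [up|up] := leP 0 (u p).
  have nu : nbhs p [set q | - d < u q].
    apply: (cu p [set r | - d < r]); apply: open_nbhs_nbhs.
    by split; [exact: open_gt|rewrite /=; lra].
  have [V [cV Vp sV]] := h0 _ _ nu.
  have PhiV : Phi (P `\` V) by exists V.
  have nV' : nbhs p V by apply: open_nbhs_nbhs; split=> //; exact: cV.1.
  by have [q [[_ nq] /nq]] := clp _ _ PhiV nV'.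
have PhiP : Phi P.
  by exists set0; [split=> //; exact: clopen0|move=> q []].
have nu : nbhs p [set q | u q < 0].
  by apply: (cu p [set r | r < 0]); apply: open_nbhs_nbhs; split; [exact: open_lt|].
by have [q [/= Pq uq]] := clp _ _ PhiP nu; move: Pq; rewrite /P/=; lra.
Qed.

(** Take 1 on the clopen set and -1 off it; the tolerance [d] absorbs the points of that set where
    [u] is slightly negative. *)
Lemma exists_sign_function u (d : R) : continuous u -> 0 < d ->
  exists2 e, sign_function e & forall p, - d <= u p * e p.
Proof.
move=> cu d0; have [V [[oV cV] sV PV]] := clopen_separation _ _ cu d0.
exists (fun p => if p \in V then 1 else -1).
  split=> [p|p]; last by case: ifP; rewrite ?normrN1 ?normr1.
  have [pV|pV] := pselect (V p).
    have nV : nbhs p V by exact: open_nbhs_nbhs.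
    by apply: (near_cst_continuous (1 : R)); apply: filterS nV => q /mem_set ->.
  have nV : nbhs p (~` V) by apply: open_nbhs_nbhs; split; [exact: closed_openC|].
  by apply: (near_cst_continuous (-1 : R)); apply: filterS nV => q /= nq; rewrite memNset.
move=> p; case: ifPn => [/set_mem/sV/= | /negP pV]; first by lra.
by rewrite leNgt; apply/negP => up; apply: pV; apply/mem_set/PV => /=; lra.
Qed.

(** The induction ranges over all pairs with the same [sg] and [th], and each rescaling halves the
    error. The slack [eps] pays for moving [u] into an orthant. *)
Lemma inverse_weights_bound n F G u t : contraction_pair F G -> face_weights sg th G ->
  ball1 u -> open [set t] -> `|G u t - th t * u (sg t)| <= 2 / 2 ^+ n.
Proof.
elim: n F G u => [|n IH] F G u FG GW bu ot.
  rewrite expr0 divr1; apply: le_trans (ler_normB _ _) _.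
  rewrite normrM norm_th// mul1r.
  by have := (inverse_ball _ _ FG _ bu).2 t; have := bu.2 (sg t); lra.
apply/ler_addgt0Pr => eps eps0.
have eps2 : 0 < eps / 2 by lra.
have [r r0 rP] := inverse_continuous _ _ FG _ bu _ eps2.
pose d := Num.min r (eps / 2).
have d0 : 0 < d by rewrite /d lt_min r0.
have dr : d <= r by rewrite /d ge_min lexx.
have de : d <= eps / 2 by rewrite /d ge_min lexx orbT.
have [e se ue] := exists_sign_function _ _ bu.1 d0.
(* [v] is [e] times the positive part of [e * u], so it lies in the orthant of [e], within [d] of
   [u]. *)
pose v p := 2^-1 * u p + 2^-1 * (e p * `|u p|).
have cv : continuous v.
  apply: continuous_lincomb; first exact: bu.1.
  move=> p; apply: cvgM; first exact: se.1.
  by apply: cvg_norm; exact: bu.1.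
have uv p : `|u p - v p| <= d.
  move: (ue p); rewrite /v ler_norml.
  by case/norm1P: (se.2 p) => ->; case: (ger0P (u p)); lra.
pose w p := 2 * v p + (-1) * e p.
have bw : ball1 w.
  split=> [|p]; first exact: continuous_lincomb cv se.1.
  move: (bu.2 p); rewrite /w /v !ler_norml.
  by case/norm1P: (se.2 p) => ->; case: (ger0P (u p)); lra.
have bv : ball1 v.
  split=> // p; move: (bu.2 p); rewrite /v !ler_norml.
  by case/norm1P: (se.2 p) => ->; case: (ger0P (u p)); lra.
have := IH _ _ _ (orthant_pair _ _ _ FG GW se) (orthant_face_weights _ _ _ FG GW se) bw ot.
have -> : (fun p => 2^-1 * e p + 2^-1 * w p) = v by apply/funext => p; rewrite /w; lra.
rewrite (inverse_signE _ _ GW se)// /w.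
have := rP v bv (fun p => le_trans (uv p) dr) t.
have := uv (sg t).
rewrite exprS invfM; set c := 2 ^- n.
rewrite !ler_norml; case/norm1P: (norm_th _ ot) => ->; lra.
Qed.

Lemma inverse_weights F G u t : contraction_pair F G -> face_weights sg th G ->
  ball1 u -> open [set t] -> G u t = th t * u (sg t).
Proof.
move=> FG GW bu ot; apply/eqP; rewrite -subr_eq0 -normr_le0.
apply/ler_addgt0Pr => eps eps0; rewrite add0r.
have eps2 : 0 < eps / 2 by lra.
have [n _ /(_ n (leqnn _))/=] := near_infty_natSinv_expn_lt (PosNum eps2).
have := inverse_weights_bound n _ _ _ _ FG GW bu ot.
by set c := 2 ^- n; lra.
Qed.

End Weights.

Hypotheses (hcpt : compact [set: K]) (h0 : clopen_basis K).

(** The weight formula at [F u] and [F v] gives [|u t - v t| = |F u (sg t) - F v (sg t)|] for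
    isolated [t]; density does the rest. *)
Lemma contraction_pair_isometric F G u v (r : R) : contraction_pair F G ->
  ball1 u -> ball1 v ->
  (forall p, `|F u p - F v p| <= r) -> forall p, `|u p - v p| <= r.
Proof.
move=> FG bu bv Fuv.
have [sg [th [open_sg norm_th sg_inj GW]]] := exists_face_weights _ _ FG.
apply: isolated_dense_dist; [exact: bu.1|exact: bv.1|move=> t ot].
rewrite -(contractionK _ _ FG _ bu) -(contractionK _ _ FG _ bv).
have E := inverse_weights _ _ open_sg norm_th sg_inj hcpt h0 _ _ _ _ FG GW.
rewrite !E//; [|exact: contraction_ball _ _ FG _ bv|exact: contraction_ball _ _ FG _ bu].
by rewrite -mulrBr normrM norm_th// mul1r.
Qed.

(** * From suprema to pointwise bounds *)

Lemma has_ubound_range_norm f : continuous f -> has_ubound (range (fun p => `|f p|)).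
Proof.
move=> cf; have : compact (range f).
  by apply: continuous_compact => //; exact: continuous_subspaceT.
move=> /compact_bounded[M [_ /(_ (M + 1))]] h; exists (M + 1) => _ [p _ <-].
by apply: h; [lra|exists p].
Qed.

Lemma supnorm_leP f (r : R) : continuous f -> 0 <= r ->
  supnorm f <= r <-> forall p, `|f p| <= r.
Proof.
move=> cf r0; split=> [h p|h].
  by apply: le_trans h; apply: ub_le_sup; [exact: has_ubound_range_norm|exists p].
rewrite /supnorm; set A := (X in sup X).
(* For empty [K] the supremum is 0 by convention, and [0 <= r] covers this case. *)
have [->|/set0P ne] := eqVneq A set0; first by rewrite sup0.
by apply: ge_sup => // _ [p _ <-].
Qed.

Lemma supdist_leP f g (r : R) : continuous f -> continuous g -> 0 <= r ->
  supdist f g <= r <-> forall p, `|f p - g p| <= r.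
Proof.
move=> cf cg r0; have := supnorm_leP (fun p => f p - g p) r.
by apply => // p; apply: cvgB; [exact: cf|exact: cg].
Qed.

Lemma BCKP f : BCK f <-> ball1 f.
Proof.
by split=> -[cf]; [move/(supnorm_leP _ _ cf ler01)|move=> h; split=> //; apply/supnorm_leP].
Qed.

Lemma supdist_ge0 f g : continuous f -> continuous g -> 0 <= supdist f g.
Proof.
move=> cf cg; have [[p _]|np] := pselect (exists p : K, True).
  apply: le_trans (normr_ge0 (f p - g p)) _; apply: ub_le_sup; last by exists p.
  by apply: has_ubound_range_norm => q; apply: cvgB; [exact: cf|exact: cg].
rewrite /supdist; set A := (X in sup X); suff -> : A = set0 by rewrite sup0.
by apply/seteqP; split=> // a [p _ _]; apply: np; exists p.
Qed.

Lemma ball_homeomorphism_pair F : ball_homeomorphism F -> ball_nonexpansive F ->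
  exists G, contraction_pair F G.
Proof.
move=> [FB _ [G [GB FK GK Gc]]] Fne; exists G; split.
- by move=> f /BCKP/FB/BCKP.
- by move=> f /BCKP/GB/BCKP.
- by move=> f /BCKP/FK.
- by move=> f /BCKP/GK.
- move=> f g /BCKP bf /BCKP bg r fg p.
  have r0 : 0 <= r := le_trans (normr_ge0 _) (fg p).
  move: p; apply/supdist_leP => //; [exact: (FB _ bf).1|exact: (FB _ bg).1|].
  by apply: le_trans (Fne _ _ bf bg) _; apply/supdist_leP => //; [exact: bf.1|exact: bg.1].
- move=> f /BCKP bf eps eps0; have [d d0 dP] := Gc _ bf _ eps0.
  (* Halving [d] turns a pointwise bound into the strict inequality on [supdist] required by
     [dP]. *)
  exists (d / 2); first by lra.
  move=> g /BCKP bg fg; apply/supdist_leP; [exact: (GB _ bf).1|exact: (GB _ bg).1|exact: ltW|].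
  apply/ltW/dP => //; apply: (@le_lt_trans _ _ (d / 2)); last by lra.
  by apply/supdist_leP => //; [exact: bf.1|exact: bg.1|lra].
Qed.

End UnitBall.

Theorem theorem1p2 (R : realType) (K : topologicalType)
  (hcpt : compact [set: K]) (hT2 : hausdorff_space K)
  (h0 : clopen_basis K) (hiso : dense (isolated [set: K]))
  (F : (K -> R) -> (K -> R)) :
  ball_homeomorphism F -> ball_nonexpansive F -> ball_isometry F.
Proof.
(* The reverse inequality is [contraction_pair_isometric] with [r] the distance between the
   images. *)
move=> hF nF f g bf bg; apply/eqP; rewrite eq_le nF//=.
have [FB _ _] := hF.
have [G FG] := ball_homeomorphism_pair _ _ hcpt _ hF nF.
have [[cFf _] [cFg _]] := (FB _ bf, FB _ bg).
have d0 := supdist_ge0 _ _ hcpt _ _ cFf cFg.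
apply/(supdist_leP _ _ hcpt) => //; [exact: bf.1|exact: bg.1|].
apply: (contraction_pair_isometric _ _ hT2 hiso hcpt h0 _ _ _ _ _ FG).
- exact/(BCKP _ _ hcpt).
- exact/(BCKP _ _ hcpt).
- exact/(supdist_leP _ _ hcpt).
Qed.
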